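(* Let $L=\{d\}$ be the signature whose only symbol is the distance symbol $d$, with bound $[0,1]$, and let $\Omega=\Omega_{\mathrm L}$ be the 1-Lipschitz weak modulus, $\Omega_{\mathrm L}(\delta)=\sup_i\delta_i$. Then for any two separable complete metric spaces $A,B$ of diameter at most $1$, $$r_\infty(A,B)=d_{\mathrm{GH}}(A,B),$$ where $r_\infty$ is computed with respect to $\Omega_{\mathrm L}$ and $d_{\mathrm{GH}}$ is the Gromov–Hausdorff distance.
   Context: For closed subsets $A,B$ of a metric space $(C,d)$, $d_{\mathrm H}(A,B)=\max\bigl(\sup_{x\in A}d(x,B),\sup_{y\in B}d(y,A)\bigr)$. For metric spaces $A,B$, $d_{\mathrm{GH}}(A,B)=\inf_{f_1,f_2}d_{\mathrm H}(f_1(A),f_2(B))$ over all isometric embeddings $f_1,f_2$ of $A,B$ into a third metric space $C$. Basic formulas. In the signature $\{d\}$, atomic formulas are $d(x_i,x_j)$ with variables among $x_0,x_1,\dots$; the modulus of $d(x_i,x_j)$ is $\Delta(\delta)=\delta_i+\delta_j$ and its bound is $[0,1]$. A basic formula is $\phi=f(\phi_0,\dots,\phi_{m-1})$ with $\phi_l$ atomic and $f:[0,1]^m\to\mathbb R$ continuous; its modulus is $\Delta_\phi=\Delta_f\circ(\Delta_{\phi_l})_{l<m}$, where $\Delta_f(\delta)=\sup\{|f(x)-f(y)|:x,y\in[0,1]^m,\ |x_l-y_l|\le\delta_l\}$. $\phi^A$ is its interpretation in a metric space $A$. A basic formula depending only on $x_0,\dots,x_{n-1}$ is a basic $n$-ary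 $\Omega_{\mathrm L}$-formula if $\Delta_\phi(\delta_0,\dots,\delta_{n-1})\le\max_{i<n}\delta_i$ for all $\delta\in[0,\infty)^n$. Back-and-forth pseudo-distances (with respect to $\Omega_{\mathrm L}$), with values in $[0,\infty]$, for $\bar a\in A^n,\bar b\in B^n$: $r_0(A\bar a,B\bar b)=\sup_\phi|\phi^A(\bar a)-\phi^B(\bar b)|$ over all basic $n$-ary $\Omega_{\mathrm L}$-formulas $\phi$; $r_\alpha=\sup_{\beta<\alpha}r_\beta$ for $\alpha$ limit or $\alpha=\infty$ (greater than all ordinals); $r_{\alpha+1}(A\bar a,B\bar b)=\sup_{c\in A,d\in B}\inf_{c'\in A,d'\in B}\max\bigl(r_\alpha(A\bar ac,B\bar bd'),r_\alpha(A\bar ac',B\bar bd)\bigr)$. For $n=0$ write $r_\alpha(A,B)$. *)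

(* Defs.v *)
From mathcomp Require Import all_boot all_order all_algebra.
From mathcomp Require Import wochoice.
From mathcomp Require Import all_classical all_reals all_analysis.

Set Implicit Arguments.
Unset Strict Implicit.
Unset Printing Implicit Defensive.

Import Order.TTheory GRing.Theory Num.Theory.
Import numFieldNormedType.Exports.

Local Open Scope classical_set_scope.
Local Open Scope ring_scope.

(* Supremum in [0, +oo]: the supremum of the empty set is 0, not -oo. *)
Definition sup0 {R : realType} (S : set (\bar R)) : \bar R :=
  ereal_sup (0%E |` S).

Section MetricSpaces.
Context {R : realType}.

Definition separable_space (T : metricType R) : Prop :=
  exists2 S : set T, countable S & dense S.

(* The axiom of [completeType], without its requirement that [T] be pointed. *)
Definition complete_space (T : metricType R) : Prop :=
  forall F : set_system T, ProperFilter F -> cauchy F -> exists l : T, F --> l.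

Definition diameter_le1 (T : metricType R) : Prop :=
  forall x y : T, mdist x y <= 1.

Definition isometric_embedding (S T : metricType R) (f : S -> T) : Prop :=
  forall x y : S, mdist (f x) (f y) = mdist x y.

Definition dist_to_set (C : metricType R) (x : C) (B : set C) : \bar R :=
  ereal_inf [set (mdist x y)%:E | y in B].

Definition hausdorff_dist (C : metricType R) (A B : set C) : \bar R :=
  maxe (sup0 [set dist_to_set x B | x in A])
       (sup0 [set dist_to_set y A | y in B]).

Definition gromov_hausdorff_dist (A B : metricType R) : \bar R :=
  ereal_inf [set v | exists (C : metricType R) (f1 : A -> C) (f2 : B -> C),
    [/\ isometric_embedding f1, isometric_embedding f2 &
        v = hausdorff_dist (range f1) (range f2)]].

End MetricSpaces.

Section BasicFormulas.
Variable R : realType.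

Definition unit_cube (m : nat) : set 'rV[R]_m :=
  [set x | forall l, 0 <= x ord0 l <= 1].

(* [BasicFormula atom f _] is f(d(x_{i_0}, x_{j_0}), .., d(x_{i_{m-1}},
   x_{j_{m-1}})) with [atom l = (i_l, j_l)].  Only the values of [bf_fun] on
   the unit cube are ever used. *)
Record basic_formula (n : nat) := BasicFormula {
  bf_size : nat ;
  bf_atom : 'I_bf_size -> 'I_n * 'I_n ;
  bf_fun : 'rV[R]_bf_size -> R ;
  bf_continuous : {within unit_cube (m := bf_size), continuous bf_fun} }.

Arguments bf_fun [n] phi : rename.
Arguments bf_atom [n] phi : rename.

Definition bf_interp (n : nat) (phi : basic_formula n) (A : metricType R)
    (a : n.-tuple A) : R :=
  bf_fun phi (\row_(l < bf_size phi)
    mdist (tnth a (bf_atom phi l).1) (tnth a (bf_atom phi l).2)).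

Definition atom_modulus (n : nat) (ij : 'I_n * 'I_n) (delta : 'I_n -> R) : R :=
  delta ij.1 + delta ij.2.

Definition fun_modulus (m : nat) (f : 'rV[R]_m -> R) (delta : 'I_m -> R)
    : \bar R :=
  ereal_sup [set v | exists x y : 'rV[R]_m,
    [/\ unit_cube x, unit_cube y,
        forall l, `|x ord0 l - y ord0 l| <= delta l &
        v = (`|f x - f y|)%:E]].

Definition bf_modulus (n : nat) (phi : basic_formula n) (delta : 'I_n -> R)
    : \bar R :=
  fun_modulus (bf_fun phi) (fun l => atom_modulus (bf_atom phi l) delta).

Definition omegaL_formula (n : nat) (phi : basic_formula n) : Prop :=
  forall delta : 'I_n -> R, (forall i, 0 <= delta i) ->
    (bf_modulus phi delta <= (\big[Num.max/0]_(i < n) delta i)%:E)%E.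

End BasicFormulas.

(* Ordinals are represented by the elements of well-ordered types: [w : W]
   stands for the order type of the set of its strict predecessors. *)
Section WellOrders.
Context {W : Type} (le : rel W).

Definition strict_pred (v w : W) : Prop := ~~ le w v.

Definition immediate_pred (v w : W) : Prop :=
  strict_pred v w /\ (forall u, strict_pred u w -> le u v).

Lemma well_order_wf : well_order le -> well_founded strict_pred.
Proof.
move=> wo; apply: contrapT => nwf.
have [w nAw] : exists w, ~ Acc strict_pred w by apply/existsNP.
have [|z [[zS zmin] _]] := wo [pred x | `[< ~ Acc strict_pred x >]].
  by exists w; apply/asboolP.
move: zS => /asboolP; apply; constructor => y yz.
apply: contrapT => nAy; move/negP: yz; apply; apply: zmin.
by apply/asboolP.
Qed.

Lemma immediate_pred_unique (u v w : W) : well_order le ->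
  immediate_pred u w -> immediate_pred v w -> u = v.
Proof.
move=> wo [uw umax] [vw vmax].
pose P := [pred x | `[< x = u \/ x = v >]].
have Pu : u \in P by apply/asboolP; left.
have Pv : v \in P by apply/asboolP; right.
have [z [_ zuniq]] : exists! z, minimum_of le P z by apply: wo; exists u.
have <- : z = u by apply: zuniq; split=> // x /asboolP[->|->]; [exact: umax|exact: vmax].
by apply: zuniq; split=> // x /asboolP[->|->]; [exact: umax|exact: vmax].
Qed.

End WellOrders.

Section BackAndForth.
Context {R : realType} (A B : metricType R).

Definition bf_family := forall n : nat, n.-tuple A -> n.-tuple B -> \bar R.

Definition r_zero : bf_family := fun n a b =>
  ereal_sup [set (`|bf_interp phi a - bf_interp phi b|)%:E |
              phi in @omegaL_formula R n].

Definition r_succ (r : bf_family) : bf_family := fun n a b =>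
  sup0 [set ereal_inf [set maxe (r n.+1 [tuple of rcons a cd.1]
                                        [tuple of rcons b cd'.2])
                                (r n.+1 [tuple of rcons a cd'.1]
                                        [tuple of rcons b cd.2])
                      | cd' in [set: A * B]]
       | cd in [set: A * B]].

Section Ordinal.
Context {W : Type} (le : rel W) (wo : well_order le).

Definition r_ord_body (w : W)
    (r : forall v, strict_pred le v w -> bf_family) : bf_family :=
  match pselect (exists v, immediate_pred le v w) with
  | left w_succ => r_succ (r (projT1 (cid w_succ)) (projT2 (cid w_succ)).1)
  | right _ =>
    if `[< exists v, strict_pred le v w >] then fun n a b =>
      ereal_sup [set x | exists v (vw : strict_pred le v w), x = r v vw n a b]
    else r_zero
  end.

(* [r_ord w] is r_alpha for the ordinal alpha represented by [w]; the three
   recursion clauses are [r_ord_zero], [r_ord_succ] and [r_ord_limit] below. *)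
Definition r_ord : W -> bf_family :=
  Fix (well_order_wf wo) (fun=> bf_family) r_ord_body.

Lemma r_ord_unfold w :
  r_ord w = r_ord_body (fun v (_ : strict_pred le v w) => r_ord v).
Proof.
rewrite /r_ord Fix_eq// => x f g fg; congr r_ord_body.
apply: functional_extensionality_dep => v.
exact: functional_extensionality_dep.
Qed.

Lemma r_ord_zero w : (forall v, ~ strict_pred le v w) -> r_ord w = r_zero.
Proof.
move=> w0; rewrite r_ord_unfold /r_ord_body; case: pselect => [p|_].
  by case: (w0 _ (projT2 (cid p)).1).
by case: asboolP => // -[v /w0].
Qed.

Lemma r_ord_succ v w : immediate_pred le v w -> r_ord w = r_succ (r_ord v).
Proof.
move=> vw; rewrite r_ord_unfold /r_ord_body.
case: pselect => [p|[]]; last by exists v.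
case: (cid p) => u uw /=; congr (r_succ (r_ord _)).
exact: (immediate_pred_unique wo uw vw).
Qed.

Lemma r_ord_limit w : (exists v, strict_pred le v w) ->
    ~ (exists v, immediate_pred le v w) ->
  r_ord w = fun n a b =>
    ereal_sup [set r_ord v a b | v in [set v | strict_pred le v w]].
Proof.
move=> w0 wlim; rewrite r_ord_unfold /r_ord_body; case: pselect => // _.
case: asboolP => // _.
apply: functional_extensionality_dep => n; apply/funext => a; apply/funext => b.
congr ereal_sup; apply/seteqP; split=> x /=.
  by move=> [v [vw ->]]; exists v.
by move=> [v vw <-]; exists v, vw.
Qed.

End Ordinal.

Definition r_infty : bf_family := fun n a b =>
  ereal_sup [set x | exists (W : Type) (le : rel W) (wo : well_order le) (w : W),
    x = r_ord wo w a b].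

End BackAndForth.

(* Main.v *)
Require Import Defs.
From HB Require Import structures.
From mathcomp Require Import all_boot all_order all_algebra.
From mathcomp Require Import all_classical all_reals all_analysis.
From mathcomp Require Import wochoice lra.

Set Implicit Arguments.
Unset Strict Implicit.
Unset Printing Implicit Defensive.

Import Order.TTheory GRing.Theory Num.Theory.
Import numFieldNormedType.Exports.

Local Open Scope classical_set_scope.
Local Open Scope ring_scope.

(* If A and B sit isometrically in C at Hausdorff distance less than s, then
   induction on alpha gives r_alpha(Aa, Bb) <= s as soon as d(a_i, b_i) <= s
   for all i.  Conversely, r_alpha increases with alpha, hence is eventually
   constant, so r_infty is a fixed point of the successor step and
   r_infty(A, B) < s propagates along a back-and-forth over dense sequences of
   A and B without any loss in s.  The formula d(x_i, x_j)/2 is 1-Lipschitz,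
   so the resulting correspondence has distortion at most 2s; setting
   d(x, y) = inf_i d(x, a_i) + s + d(b_i, y) on the disjoint union of A and B
   puts them at Hausdorff distance at most s. *)

(** * Cantor's theorem and elementary facts on well-orders *)

Lemma powerset_not_injective (T : Type) (f : set T -> T) :
  exists S S' : set T, S <> S' /\ f S = f S'.
Proof.
apply: contrapT => finj.
have inj S S' : f S = f S' -> S = S'.
  by move=> SS'; apply: contrapT => neqS; apply: finj; exists S, S'.
(* Cantor's diagonal set: the images under [f] of the sets that miss their own image. *)
pose D := [set x | exists S, f S = x /\ ~ S x].
have DfD : D (f D).
  apply: contrapT => nD; apply: nD; exists D; split => // DfD.
  by have [S [/inj -> ]] := DfD; apply.
by have [S [/inj -> ]] := DfD; apply.
Qed.

Lemma well_order_refl (T : Type) (le : rel T) u : well_order le -> le u u.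
Proof.
move=> wo; have [|z [[/asboolP zu zmin] _]] := wo [pred x | `[< x = u >]].
  by exists u; apply/asboolP.
by rewrite -{1}zu; apply: zmin; apply/asboolP.
Qed.

(** Both [u] and [v] are minima of the pair they form, and [well_order] makes minima unique. *)
Lemma well_order_antisym (T : Type) (le : rel T) u v :
  well_order le -> le u v -> le v u -> u = v.
Proof.
move=> wo uv vu; have [|z [_ zuniq]] := wo [pred y | `[< y = u \/ y = v >]].
  by exists u; apply/asboolP; left.
have <- : z = u.
  apply: zuniq; split=> [|y /asboolP[]->//]; last exact: well_order_refl.
  by apply/asboolP; left.
apply: zuniq; split=> [|y /asboolP[]->//]; last exact: well_order_refl.
by apply/asboolP; right.
Qed.

(** * Monotonicity of the transfinite sequence and its stationary value *)

Section Ordinals.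
Context {R : realType} {A B : metricType R}.
Local Notation family := (bf_family A B).

Definition bf_le (r r' : family) :=
  forall n (a : n.-tuple A) (b : n.-tuple B), (r n a b <= r' n a b)%E.

Lemma bf_le_trans r1 r2 r3 : bf_le r1 r2 -> bf_le r2 r3 -> bf_le r1 r3.
Proof. by move=> r12 r23 n a b; exact: le_trans (r12 n a b) (r23 n a b). Qed.

Lemma bf_le_anti r1 r2 : bf_le r1 r2 -> bf_le r2 r1 -> r1 = r2.
Proof.
move=> r12 r21; apply: functional_extensionality_dep => n.
apply/funext => a; apply/funext => b.
by apply/eqP; rewrite eq_le r12 r21.
Qed.

Lemma r_succ_ge0 (r : family) n (a : n.-tuple A) (b : n.-tuple B) :
  (0 <= r_succ r a b)%E.
Proof. by apply: ereal_sup_ubound; left. Qed.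

Lemma r_succ_le (r r' : family) : bf_le r r' -> bf_le (r_succ r) (r_succ r').
Proof.
move=> rr' n a b; apply: ge_ereal_sup => _ [->|[cd _ <-]].
  exact: r_succ_ge0.
apply: (@le_trans _ _ (ereal_inf [set maxe (r' n.+1 [tuple of rcons a cd.1]
                                        [tuple of rcons b cd'.2])
                                (r' n.+1 [tuple of rcons a cd'.1]
                                        [tuple of rcons b cd.2])
                      | cd' in [set: A * B]])); last first.
  by apply: ereal_sup_ubound; right; exists cd.
apply: le_ereal_inf_tmp => _ [cd' _ <-].
apply: ge_ereal_inf; eexists; first by exists cd'.
by rewrite ge_max !le_max !rr'/= orbT.
Qed.

(** An infimum strictly below [s] has a member below [s]. The answers thus exist for the same [s],
    which is why the back-and-forth loses nothing. *)
Lemma r_succ_lt (r : family) n (a : n.-tuple A) (b : n.-tuple B) s :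
    (r_succ r a b < s)%E -> forall c d, exists c' d',
  (r n.+1 [tuple of rcons a c] [tuple of rcons b d'] < s)%E /\
  (r n.+1 [tuple of rcons a c'] [tuple of rcons b d] < s)%E.
Proof.
move=> rs c d.
have /ereal_inf_lt[_ [[c' d'] _ <-]] : (ereal_inf [set maxe
    (r n.+1 [tuple of rcons a c] [tuple of rcons b cd'.2])
    (r n.+1 [tuple of rcons a cd'.1] [tuple of rcons b d])
      | cd' in [set: A * B]] < s)%E.
  apply: le_lt_trans rs; apply: ereal_sup_ubound; right.
  by exists (c, d).
by rewrite gt_max => /andP[? ?]; exists c', d'.
Qed.

(** If [r_succ r] were smaller at [a], [b], then [r_succ_lt] would extend these tuples to ones where
    [r] is smaller. Points of both spaces keep the supremum from being over an empty set. *)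
Lemma le_r_succ (r : family) : inhabited A -> inhabited B ->
    (forall n (a : n.-tuple A) (b : n.-tuple B) c d, (r n a b <=
      r n.+1 [tuple of rcons a c] [tuple of rcons b d])%E) ->
  bf_le r (r_succ r).
Proof.
move=> [c] [d] rle n a b; rewrite leNgt; apply/negP => /r_succ_lt.
by move=> /(_ c d)[c' [d' [+ _]]]; rewrite ltNge rle.
Qed.

(** The only element of a well-ordered [unit] represents the ordinal 0. *)
Lemma r_zero_le_infty : bf_le (@r_zero R A B) (@r_infty R A B).
Proof.
have [le wo] := well_ordering_principle unit.
rewrite -(r_ord_zero _ _ wo (w := tt)); last first.
  by case; apply/negP/negPn; exact: well_order_refl.
by move=> n a b; apply: ereal_sup_ubound; exists unit, le, wo, tt.
Qed.

(** What [le_r_succ] asks for at the ordinal 0; [r0_rcons] is established below as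
    [r_zero_rcons]. *)
Context (iA : inhabited A) (iB : inhabited B)
  (r0_rcons : forall n (a : n.-tuple A) (b : n.-tuple B) c d, (r_zero a b <=
      @r_zero R A B n.+1 [tuple of rcons a c] [tuple of rcons b d])%E).

(** The two bounds share one induction: at the successor of [v], the first bound is the chain of
    both bounds at [v]. *)
Lemma le_r_ord_succ (W : Type) (le : rel W) (wo : well_order le) w :
  bf_le (@r_zero R A B) (r_ord wo w) /\
  bf_le (r_ord wo w) (r_succ (r_ord wo w)).
Proof.
elim: (well_order_wf wo w) => {}w _ IH.
have [[v vw]|nsucc] := pselect (exists v, immediate_pred le v w).
  rewrite (r_ord_succ _ _ wo vw); have [r0v rv] := IH _ vw.1.
  by split; [exact: bf_le_trans r0v rv|exact: r_succ_le].
have [w0|w0] := pselect (exists v, strict_pred le v w); last first.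
  rewrite (r_ord_zero _ _ wo); last by move=> v vw; apply: w0; exists v.
  by split; [move=> n a b|exact: le_r_succ].
have vw v : strict_pred le v w -> bf_le (r_ord wo v) (r_ord wo w).
  move=> vw n a b; rewrite (r_ord_limit _ _ wo w0 nsucc).
  by apply: ereal_sup_ubound; exists v.
split.
  by have [v vw'] := w0; apply: bf_le_trans (vw _ vw'); have [] := IH _ vw'.
(* At a limit, each earlier [r_ord wo v] lies below its own [r_succ], hence below that of
   [r_ord wo w]. *)
move=> n a b; rewrite {1}(r_ord_limit _ _ wo w0 nsucc).
apply: ge_ereal_sup => _ [v vw' <-].
apply: le_trans (r_succ_le (vw _ vw') a b).
by have [_] := IH _ vw'; exact.
Qed.

Lemma r_ord_le (W : Type) (le : rel W) (wo : well_order le) v w :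
  strict_pred le v w -> bf_le (r_ord wo v) (r_ord wo w).
Proof.
elim: (well_order_wf wo w) => {}w _ IH vw.
have [[u uw]|nsucc] := pselect (exists v, immediate_pred le v w).
  rewrite (r_ord_succ _ _ wo uw); apply: (@bf_le_trans _ (r_ord wo u)).
    (* [u] is the largest element strictly below [w], so [v] is either [u] or strictly below it. *)
    have [uv|nuv] := boolP (le u v); last exact: IH uw.1 nuv.
    have -> // : u = v.
    exact: (well_order_antisym wo uv (uw.2 _ vw)).
  by have [] := @le_r_ord_succ _ _ wo u.
have w0 : exists v, strict_pred le v w by exists v.
move=> n a b; rewrite (r_ord_limit _ _ wo w0 nsucc).
by apply: ereal_sup_ubound; exists v.
Qed.

(* By Cantor's theorem [r_ord] is not injective on a well-ordering of
   [set family]; being monotone, it is stationary from there on. *)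
Lemma r_infty_fixpoint : r_succ (@r_infty R A B) = @r_infty R A B.
Proof.
have [le wo] := well_ordering_principle {classic set family}.
have [v [w [vw rvw]]] :
    exists v w, strict_pred le v w /\ r_ord wo v = @r_ord R A B _ le wo w.
  have [v [w [neq e]]] := @powerset_not_injective family (@r_ord R A B _ le wo).
  have [lewv|] := boolP (le w v); last by exists v, w.
  have [levw|] := boolP (le v w); last by exists w, v.
  by case: neq; exact: (well_order_antisym wo levw lewv).
pose rho : family := r_ord wo v.
have fix_v : r_succ rho = rho.
  (* The least [u] above [v] is its successor and is at most [w]. So [r_succ rho], which is
     [r_ord wo u], lies below [r_ord wo w], which is [rho]. *)
  have [|u [[vu umin] _]] := wo [pred x | ~~ le x v]; first by exists w.
  have ivu : immediate_pred le v u.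
    split=> // x xu; apply: contraNT xu => xv.
    exact: umin.
  apply: bf_le_anti; last by have [] := @le_r_ord_succ _ _ wo v.
  rewrite /rho -(r_ord_succ _ _ wo ivu) rvw.
  have [wu|] := boolP (le w u); last exact: r_ord_le.
  have -> // : w = u by exact: (well_order_antisym wo wu (umin _ vw)).
suff -> : @r_infty R A B = rho by [].
apply: bf_le_anti => n a b; last first.
  by apply: ereal_sup_ubound; exists _, le, wo, v.
apply: ge_ereal_sup => _ [W' [le' [wo' [w' ->]]]].
move: n a b; rewrite -/(bf_le (r_ord wo' w') rho).
(* A fixed point of the monotone [r_succ] that lies above [r_zero] bounds every [r_ord], over any
   well-order. *)
elim: (well_order_wf wo' w') => x _ IH.
have [[u ux]|nsucc] := pselect (exists v, immediate_pred le' v x).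
  rewrite (r_ord_succ _ _ wo' ux) -fix_v; apply: r_succ_le; exact: IH ux.1.
have [x0|x0] := pselect (exists v, strict_pred le' v x); last first.
  rewrite (r_ord_zero _ _ wo'); last by move=> u ux; apply: x0; exists u.
  by have [] := @le_r_ord_succ _ _ wo v.
move=> n a b; rewrite (r_ord_limit _ _ wo' x0 nsucc).
by apply: ge_ereal_sup => _ [u ux <-]; exact: IH.
Qed.

End Ordinals.

(** * Basic formulas, and the upper bound from a common isometric embedding *)

Section Formulas.
Context {R : realType}.
Implicit Types A B : metricType R.

Lemma tnth_rcons_widen (T : Type) n (t : n.-tuple T) x (i : 'I_n) :
  tnth [tuple of rcons t x] (widen_ord (leqnSn n) i) = tnth t i.
Proof.
by rewrite !(tnth_nth x)/= nth_rcons size_tuple ltn_ord.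
Qed.

Lemma tnth_rcons_max (T : Type) n (t : n.-tuple T) x :
  tnth [tuple of rcons t x] ord_max = x.
Proof. by rewrite (tnth_nth x)/= nth_rcons size_tuple ltnn eqxx. Qed.

Definition bf_widen n (phi : basic_formula R n) : basic_formula R n.+1 :=
  @BasicFormula R n.+1 (bf_size phi)
    (fun l => (widen_ord (leqnSn n) (@bf_atom _ _ phi l).1,
               widen_ord (leqnSn n) (@bf_atom _ _ phi l).2))
    (@bf_fun _ _ phi) (@bf_continuous _ _ phi).

Lemma bf_interp_widen A n (phi : basic_formula R n) (a : n.-tuple A) c :
  bf_interp (bf_widen phi) [tuple of rcons a c] = bf_interp phi a.
Proof.
rewrite /bf_interp/=; congr bf_fun; apply/rowP => l.
by rewrite !mxE !tnth_rcons_widen.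
Qed.

Lemma omegaL_widen n (phi : basic_formula R n) :
  omegaL_formula phi -> omegaL_formula (bf_widen phi).
Proof.
move=> phiL delta delta0.
have := phiL (fun i => delta (widen_ord (leqnSn n) i)) (fun=> delta0 _).
move=> /le_trans; apply; rewrite lee_fin; apply/bigmax_leP.
by split=> [|i _]; [exact: bigmax_ge_id|exact: le_bigmax].
Qed.

(** A formula can be read with one more variable that does not occur in it, so longer tuples are
    tested by at least as many formulas. *)
Lemma r_zero_rcons A B n (a : n.-tuple A) (b : n.-tuple B) c d :
  (r_zero a b <=
    @r_zero R A B n.+1 [tuple of rcons a c] [tuple of rcons b d])%E.
Proof.
apply: ge_ereal_sup => _ [phi phiL <-]; apply: ereal_sup_ubound.
exists (bf_widen phi); first exact: omegaL_widen.
by rewrite !bf_interp_widen.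
Qed.

Lemma half_coord_continuous :
  {within unit_cube (m := 1), continuous (fun x : 'rV[R]_1 => x ord0 ord0 / 2)}.
Proof.
apply: continuous_subspaceT => x.
apply: (@cvgM _ _ _ (nbhs_filter x) (fun y => y ord0 ord0) (fun=> 2^-1)).
  exact: (@coord_continuous R 1 1 ord0 ord0 x).
exact: cvg_cst.
Qed.

Definition half_dist_formula n (i j : 'I_n) : basic_formula R n :=
  BasicFormula (fun=> (i, j)) half_coord_continuous.

(** The modulus of an atom is a sum of two [delta]s, up to twice their maximum; the factor 1/2
    compensates exactly. *)
Lemma omegaL_half_dist n (i j : 'I_n) : omegaL_formula (half_dist_formula i j).
Proof.
move=> delta delta0; apply: ge_ereal_sup => _ [x [y [_ _ /(_ ord0) xy ->]]].
rewrite lee_fin/= -mulrBl normrM (ger0_norm (x := 2^-1))//.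
rewrite ler_pdivrMr// (le_trans xy)// /atom_modulus/= mulr_natr mulr2n.
by apply: lerD; exact: le_bigmax.
Qed.

Lemma r_zero_ge_distortion A B n (a : n.-tuple A) (b : n.-tuple B) i j :
  ((`|mdist (tnth a i) (tnth a j) - mdist (tnth b i) (tnth b j)| / 2)%:E
    <= r_zero a b)%E.
Proof.
apply: ereal_sup_ubound; exists (half_dist_formula i j).
  exact: omegaL_half_dist.
by rewrite /bf_interp/= !mxE -mulrBl normrM (ger0_norm (x := 2^-1)).
Qed.

(** The right-hand side is the modulus of an atom when [delta] is the displacement in [C] between
    corresponding points. *)
Lemma dist_le_embedding (A B C : metricType R) (f1 : A -> C) (f2 : B -> C)
    a a' b b' :
    isometric_embedding f1 -> isometric_embedding f2 ->
  `|mdist a a' - mdist b b'| <= mdist (f1 a) (f2 b) + mdist (f1 a') (f2 b').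
Proof.
move=> f1E f2E; rewrite -f1E -f2E.
have := metric_triangle (f1 a) (f2 b) (f1 a').
have := metric_triangle (f2 b) (f2 b') (f1 a').
have := metric_triangle (f2 b) (f1 a) (f2 b').
have := metric_triangle (f1 a) (f1 a') (f2 b').
rewrite (metric_sym (f2 b) (f1 a)) (metric_sym (f2 b') (f1 a')).
by rewrite ler_norml; lra.
Qed.

(** The modulus condition of [phi] is applied to the displacements in [C]. The diameter bounds put
    both vectors of distances in the unit cube. *)
Lemma r_zero_le_embedding (A B C : metricType R) (f1 : A -> C) (f2 : B -> C)
    n (a : n.-tuple A) (b : n.-tuple B) :
    isometric_embedding f1 -> isometric_embedding f2 ->
    diameter_le1 A -> diameter_le1 B ->
  (r_zero a b <=
    (\big[Num.max/0]_(i < n) mdist (f1 (tnth a i)) (f2 (tnth b i)))%:E)%E.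
Proof.
move=> f1E f2E dA dB; apply: ge_ereal_sup => _ [phi phiL <-].
have := phiL (fun i => mdist (f1 (tnth a i)) (f2 (tnth b i)))
  (fun=> mdist_ge0 _ _).
apply: le_trans; apply: ereal_sup_ubound.
do 2 eexists; split; last by [].
- by move=> l; rewrite mxE mdist_ge0/= dA.
- by move=> l; rewrite mxE mdist_ge0/= dB.
- by move=> l; rewrite !mxE; exact: dist_le_embedding.
Qed.

(** Answering each new point by one within [s] of it in [C] keeps the extended tuples within [s], so
    the induction on [w] applies to tuples of any length. *)
Lemma r_ord_le_embedding (A B C : metricType R) (f1 : A -> C) (f2 : B -> C)
    (W : Type) (le : rel W) (wo : well_order le) w (s : R)
    n (a : n.-tuple A) (b : n.-tuple B) :
    isometric_embedding f1 -> isometric_embedding f2 ->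
    diameter_le1 A -> diameter_le1 B ->
    0 <= s ->
    (forall c, exists d, mdist (f1 c) (f2 d) <= s) ->
    (forall d, exists c, mdist (f1 c) (f2 d) <= s) ->
    (forall i, mdist (f1 (tnth a i)) (f2 (tnth b i)) <= s) ->
  (r_ord wo w a b <= s%:E)%E.
Proof.
move=> f1E f2E dA dB s0 sA sB.
elim: (well_order_wf wo w) n a b => {}w _ IH n a b abs.
have [[v vw]|nsucc] := pselect (exists v, immediate_pred le v w).
  rewrite (r_ord_succ _ _ wo vw).
  apply: ge_ereal_sup => _ [->|[[c d] _ <-]]; first by rewrite lee_fin.
  have [d' cd'] := sA c; have [c' c'd] := sB d.
  apply: ge_ereal_inf; eexists; first by exists (c', d').
  have ext x y : mdist (f1 x) (f2 y) <= s ->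
      (r_ord wo v [tuple of rcons a x] [tuple of rcons b y] <= s%:E)%E.
    move=> xy; apply: IH vw.1 _ _ _ _ => i.
    have [j ->|->] := unliftP ord_max i; last by rewrite !tnth_rcons_max.
    have -> : lift ord_max j = widen_ord (leqnSn n) j.
      by apply/val_inj; exact: lift_max.
    by rewrite !tnth_rcons_widen.
  by rewrite ge_max !ext.
have [w0|w0] := pselect (exists v, strict_pred le v w).
  rewrite (r_ord_limit _ _ wo w0 nsucc).
  by apply: ge_ereal_sup => _ [v vw <-]; exact: IH.
rewrite (r_ord_zero _ _ wo); last by move=> v vw; apply: w0; exists v.
apply: le_trans (r_zero_le_embedding a b f1E f2E dA dB) _.
by rewrite lee_fin; apply/bigmax_leP; split.
Qed.

Lemma hausdorff_dist_lt (C : metricType R) (X Y : set C) (s : R) :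
  (hausdorff_dist X Y < s%:E)%E ->
  [/\ 0 <= s, forall x, X x -> exists2 y, Y y & mdist x y <= s &
      forall y, Y y -> exists2 x, X x & mdist x y <= s].
Proof.
rewrite /hausdorff_dist gt_max => /andP[XY YX]; split.
(* [sup0] contains 0, so this holds even when both sets are empty. *)
- rewrite -lee_fin; apply: le_trans (ltW XY).
  by apply: ereal_sup_ubound; left.
- move=> x Xx.
  have /ereal_inf_lt[_ [y Yy <-]] : (dist_to_set x Y < s%:E)%E.
    by apply: le_lt_trans XY; apply: ereal_sup_ubound; right; exists x.
  by rewrite lte_fin => /ltW; exists y.
- move=> y Yy.
  have /ereal_inf_lt[_ [x Xx <-]] : (dist_to_set y X < s%:E)%E.
    by apply: le_lt_trans YX; apply: ereal_sup_ubound; right; exists y.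
  by rewrite lte_fin metric_sym => /ltW; exists x.
Qed.

(** Reduces both inequalities of the theorem to a real [s] strictly above the larger side, where
    infima provide actual points. *)
Lemma lee_fin_gtP (x y : \bar R) :
  (forall s : R, (y < s%:E)%E -> (x <= s%:E)%E) -> (x <= y)%E.
Proof.
case: y => [y| |] xs; last 2 first.
- exact: leey.
(* For [y = -oo] every real [s] is allowed: [s = x - 1] refutes a finite [x], and [s = 0] refutes
   [+oo]. *)
- case: x xs => [x| |] // xs.
    by have := xs (x - 1)%R (ltNyr _); rewrite lee_fin lerDl oppr_ge0 ler10.
  by have := xs 0%R (ltNyr _).
apply/lee_addgt0Pr => e e0.
by rewrite -EFinD; apply: xs; rewrite lte_fin ltrDl.
Qed.

Lemma r_infty_le_gromov_hausdorff A B :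
    diameter_le1 A -> diameter_le1 B ->
  (r_infty (nil_tuple A) (nil_tuple B) <= gromov_hausdorff_dist A B)%E.
Proof.
move=> dA dB; apply: le_ereal_inf_tmp => _ [C [f1 [f2 [f1E f2E ->]]]].
apply: ge_ereal_sup => _ [W [le [wo [w ->]]]].
apply: lee_fin_gtP => s /hausdorff_dist_lt[s0 XY YX].
apply: (@r_ord_le_embedding A B C f1 f2) => //.
- by move=> c; have [|_ [d _ <-] ?] := XY (f1 c); [exists c|exists d].
- by move=> d; have [|_ [c _ <-] ?] := YX (f2 d); [exists d|exists c].
- by case.
Qed.

End Formulas.

(** * Gluing two spaces along a relation of small distortion *)

Section Glueing.
Context {R : realType} (A B : metricType R) (rel : A -> B -> Prop) (s : R).
Hypothesis s_gt0 : 0 < s.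
Hypothesis rel_nonempty : exists a b, rel a b.
Hypothesis rel_distortion : forall a b a' b', rel a b -> rel a' b' ->
  `|mdist a a' - mdist b b'| <= 2 * s.

(** Length of a shortest passage through a related pair, whose two points are put at distance [s].
    The real [inf] is a genuine infimum since [rel] is nonempty and all the sums are nonnegative. *)
Definition cross_dist (a : A) (b : B) : R :=
  inf [set mdist a p.1 + s + mdist b p.2 | p in [set p | rel p.1 p.2]].

Lemma cross_dist_le a b a' b' :
  rel a' b' -> cross_dist a b <= mdist a a' + s + mdist b b'.
Proof.
move=> ab'; apply: ge_inf; last by exists (a', b').
by exists 0 => _ [p _ <-]; rewrite !addr_ge0// ?mdist_ge0// ltW.
Qed.

Lemma cross_dist_ge a b x :
    (forall a' b', rel a' b' -> x <= mdist a a' + s + mdist b b') ->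
  x <= cross_dist a b.
Proof.
move=> xle; apply: lb_le_inf.
  by have [a' [b' ab']] := rel_nonempty; eexists; exists (a', b').
by move=> _ [[a' b'] /= ab' <-]; exact: xle.
Qed.

(** Every passage costs at least [s]; this makes the glued distance a metric and not just a
    pseudometric. *)
Lemma cross_dist_gt0 a b : 0 < cross_dist a b.
Proof.
apply: (lt_le_trans s_gt0); apply: cross_dist_ge => a' b' _.
by have := mdist_ge0 a a'; have := mdist_ge0 b b'; lra.
Qed.

Lemma cross_dist_trianglel a a' b :
  cross_dist a b <= mdist a a' + cross_dist a' b.
Proof.
rewrite addrC -lerBlDr; apply: cross_dist_ge => p q pq.
by have := cross_dist_le a b pq; have := metric_triangle a a' p; lra.
Qed.

Lemma cross_dist_triangler a b b' :
  cross_dist a b <= cross_dist a b' + mdist b' b.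
Proof.
rewrite -lerBlDr; apply: cross_dist_ge => p q pq.
have := cross_dist_le a b pq; have := metric_triangle b b' q.
by rewrite (metric_sym b b'); lra.
Qed.

(** Go from [a] to [a'] through [p] and [p']. The detour [mdist p p'] is at most
    [mdist q q' + 2 * s], and the two passages pay exactly these [2 * s]. *)
Lemma mdist_le_crossl a a' b :
  mdist a a' <= cross_dist a b + cross_dist a' b.
Proof.
rewrite -lerBlDr; apply: cross_dist_ge => p q pq.
rewrite lerBlDr addrC -lerBlDr; apply: cross_dist_ge => p' q' pq'.
have := rel_distortion pq pq'; rewrite ler_norml => /andP[_].
have := metric_triangle a p a'; have := metric_triangle p p' a'.
have := metric_triangle q b q'.
by rewrite (metric_sym p' a') (metric_sym q b); lra.
Qed.

Lemma mdist_le_crossr a b b' :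
  mdist b b' <= cross_dist a b + cross_dist a b'.
Proof.
rewrite -lerBlDr; apply: cross_dist_ge => p q pq.
rewrite lerBlDr addrC -lerBlDr; apply: cross_dist_ge => p' q' pq'.
have := rel_distortion pq pq'; rewrite ler_norml => /andP[+ _].
have := metric_triangle b q b'; have := metric_triangle q q' b'.
have := metric_triangle p a p'.
by rewrite (metric_sym q' b') (metric_sym p a); lra.
Qed.

Definition glued_dist (x y : A + B) : R :=
  match x, y with
  | inl a, inl a' => mdist a a'
  | inl a, inr b => cross_dist a b
  | inr b, inl a => cross_dist a b
  | inr b, inr b' => mdist b b'
  end.

Lemma glued_distxx x : glued_dist x x = 0.
Proof. by case: x => x; exact: mdistxx. Qed.

Lemma glued_dist_positivity x y : glued_dist x y = 0 -> x = y.
Proof.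
case: x y => [a|b] [a'|b'] /=; try by move=> /mdist_positivity ->.
  by move=> ab; have := cross_dist_gt0 a b'; rewrite ab ltxx.
by move=> ab; have := cross_dist_gt0 a' b; rewrite ab ltxx.
Qed.

Lemma glued_dist_sym x y : glued_dist x y = glued_dist y x.
Proof. by case: x y => [a|b] [a'|b'] //=; exact: metric_sym. Qed.

Lemma glued_dist_triangle y x z :
  glued_dist x z <= glued_dist x y + glued_dist y z.
Proof.
case: x y z => [a|b] [a'|b'] [a''|b''] /=.
- exact: metric_triangle.
- exact: cross_dist_trianglel.
- exact: mdist_le_crossl.
- exact: cross_dist_triangler.
- by rewrite addrC metric_sym; exact: cross_dist_trianglel.
- exact: mdist_le_crossr.
- by rewrite addrC metric_sym; exact: cross_dist_triangler.
- exact: metric_triangle.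
Qed.

Definition glued : metricType R := HB.pack (A + B)%type
  (isMetric.Build R (A + B)%type glued_distxx glued_dist_positivity
    glued_dist_sym glued_dist_triangle).

(** Related points are at cross distance at most [s], so a point within [e] of a related one is
    within [s + e] of the other space. As [e] is arbitrary, it suffices that the related points be
    dense on each side. *)
Lemma gromov_hausdorff_le_distortion :
    (forall a e, 0 < e -> exists a' b', rel a' b' /\ mdist a a' < e) ->
    (forall b e, 0 < e -> exists a' b', rel a' b' /\ mdist b b' < e) ->
  (gromov_hausdorff_dist A B <= s%:E)%E.
Proof.
move=> denseA denseB.
apply: ge_ereal_inf; eexists.
  by exists glued, (inl : A -> glued), (inr : B -> glued); split.
rewrite ge_max; apply/andP; split.
- apply: ge_ereal_sup => _ [->|[_ [a _ <-] <-]]; first by rewrite lee_fin ltW.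
  apply/lee_addgt0Pr => e e0; have [a' [b' [ab' ae]]] := denseA a e e0.
  apply: ge_ereal_inf; eexists; first by exists (inr b') => //; exists b'.
  rewrite -EFinD lee_fin; apply: le_trans (cross_dist_le a b' ab') _.
  by rewrite mdistxx; lra.
- apply: ge_ereal_sup => _ [->|[_ [b _ <-] <-]]; first by rewrite lee_fin ltW.
  apply/lee_addgt0Pr => e e0; have [a' [b' [ab' be]]] := denseB b e e0.
  apply: ge_ereal_inf; eexists; first by exists (inl a') => //; exists a'.
  rewrite -EFinD lee_fin; apply: le_trans (cross_dist_le a' b ab') _.
  by rewrite mdistxx; lra.
Qed.

End Glueing.

(** * The back-and-forth construction and the lower bound on [r_infty] *)

Section BackAndForth.
Context {R : realType}.
Implicit Types A B T : metricType R.

(** [r_zero] is a plain supremum, so an admissible formula must be exhibited. The constant 0 without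
    atoms serves for every [n], including [n = 0], where there are no variables. *)
Lemma r_zero_ge0 A B n (a : n.-tuple A) (b : n.-tuple B) : (0 <= r_zero a b)%E.
Proof.
have cont : {within unit_cube (m := 0), continuous (fun _ : 'rV[R]_0 => 0 : R)}.
  by apply: continuous_subspaceT; exact: cst_continuous.
pose phi := @BasicFormula R n 0
  (fun l => False_rect _ (notF (ltn_ord l))) (fun=> 0) cont.
have phiL : omegaL_formula phi.
  move=> delta delta0; apply: ge_ereal_sup => _ [x [y [_ _ _ ->]]].
  by rewrite subrr normr0 lee_fin; exact: bigmax_ge_id.
apply: (@le_trans _ _ (`|bf_interp phi a - bf_interp phi b|)%:E).
  by rewrite lee_fin.
by apply: ereal_sup_ubound; exists phi.
Qed.

Lemma dense_sequence T : inhabited T -> separable_space T ->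
  exists u : nat -> T, forall x e, 0 < e -> exists n, mdist x (u n) < e.
Proof.
move=> [x0] [S /countable_injP[f finj] denseS].
(* [u n] is the point of [S] with code [n] under the injection [f], or [x0] if there is none. *)
have /choice[u uf] : forall n, exists x, forall y, S y -> f y = n -> x = y.
  move=> n; have [[y [Sy <-]]|nex] := pselect (exists y, S y /\ f y = n).
    by exists y => z Sz fzy; apply: finj; rewrite ?inE.
  by exists x0 => y Sy fyn; case: nex; exists y.
exists u => x e e0.
have [|y [ye Sy]] := denseS (ball x e)° _ (open_interior _).
  by exists x; exact: nbhsx_ballx.
exists (f y); rewrite (uf _ _ Sy erefl).
by have := interior_subset ye; rewrite ballEmdist.
Qed.

(** Stage [k] adds one pair containing [u k] and then one containing [v k], keeping the invariant
    [Q] of finite lists. *)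
Lemma back_and_forth (X Y : eqType) (Q : seq (X * Y) -> Prop)
    (u : nat -> X) (v : nat -> Y) : Q [::] ->
    (forall l x y, Q l ->
      exists x' y', Q (rcons l (x, y')) /\ Q (rcons l (x', y))) ->
  exists L : nat -> seq (X * Y), [/\ forall k, Q (L k),
    {homo L : k m / (k <= m)%N >-> {subset k <= m}},
    forall k, exists y, (u k, y) \in L k.+1 &
    forall k, exists x, (x, v k) \in L k.+1].
Proof.
move=> Q0 Qext.
have /choice[F FP] : forall lk : seq (X * Y) * nat, exists l' : seq (X * Y),
    Q lk.1 -> [/\ Q l', {subset lk.1 <= l'},
      exists y, (u lk.2, y) \in l' & exists x, (x, v lk.2) \in l'].
  (* Outside [Q] the value is arbitrary; it only makes the choice function total. *)
  move=> [l k] /=; have [Ql|nQl] := pselect (Q l); last by exists [::].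
  (* Each call of [Qext] answers on both sides: the first is used only for [u k], the second, on the
     longer list, only for [v k]. *)
  have [_ [y [Ql1 _]]] := Qext _ (u k) (v k) Ql.
  have [x [_ [_ Ql2]]] := Qext _ (u k) (v k) Ql1.
  exists (rcons (rcons l (u k, y)) (x, v k)) => _; split => //.
  - by move=> z zl; rewrite !(mem_rcons, in_cons) zl !orbT.
  - by exists y; rewrite !(mem_rcons, in_cons) eqxx orbT.
  - by exists x; rewrite mem_rcons mem_head.
pose L := fix L k := if k is k'.+1 then F (L k', k') else [::].
have QL k : Q (L k) by elim: k => [|k QLk] /=; [|have [] := FP (L k, k) QLk].
exists L; split => //.
- move=> k m; elim: m => [|m IH]; first by rewrite leqn0 => /eqP ->.
  rewrite leq_eqVlt => /predU1P[-> //|/IH km] z /km.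
  by have [_ + _ _] := FP (L m, m) (QL m); apply.
- by move=> k; have [] := FP (L k, k) (QL k).
- by move=> k; have [] := FP (L k, k) (QL k).
Qed.

Lemma gromov_hausdorff_le_r_infty A B :
    inhabited A -> inhabited B -> separable_space A -> separable_space B ->
  (gromov_hausdorff_dist A B <= r_infty (nil_tuple A) (nil_tuple B))%E.
Proof.
move=> iA iB sA sB; apply: lee_fin_gtP => s rs.
have [u uP] := dense_sequence iA sA; have [v vP] := dense_sequence iB sB.
(* The invariant is strict, as [r_succ_lt] requires. *)
pose Q (l : seq (A * B)) := exists n (a : n.-tuple A) (b : n.-tuple B),
  zip a b = l /\ (r_infty a b < s%:E)%E.
have Q0 : Q [::] by exists 0, (nil_tuple A), (nil_tuple B).
have Qext l x y : Q l ->
    exists x' y', Q (rcons l (x, y')) /\ Q (rcons l (x', y)).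
  move=> [n [a [b [<- abs]]]].
  (* At the fixed point, the extended tuples satisfy the bound for [r_infty] itself, not for some
     earlier stage. *)
  rewrite -(r_infty_fixpoint iA iB (@r_zero_rcons R A B)) in abs.
  have [x' [y' [xy' x'y]]] := r_succ_lt abs x y.
  exists x', y'; split.
    exists n.+1, [tuple of rcons a x], [tuple of rcons b y']; split => //.
    by rewrite zip_rcons ?size_tuple.
  exists n.+1, [tuple of rcons a x'], [tuple of rcons b y]; split => //.
  by rewrite zip_rcons ?size_tuple.
have Qdist l : Q l -> forall p q, p \in l -> q \in l ->
    `|mdist p.1 q.1 - mdist p.2 q.2| <= 2 * s.
  move=> [n [a [b [<- abs]]]].
  have tnthP p : p \in zip a b ->
      exists i, p.1 = tnth a i /\ p.2 = tnth b i.
    case: p => x y /(nthP (x, y))[i]; rewrite size_zip !size_tuple minnn => ilt.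
    rewrite nth_zip ?size_tuple// => -[xi yi]; exists (Ordinal ilt).
    by rewrite (tnth_nth x) (tnth_nth y) /= xi yi.
  move=> p q /tnthP[i [-> ->]] /tnthP[j [-> ->]].
  have : `|mdist (tnth a i) (tnth a j) - mdist (tnth b i) (tnth b j)| / 2 <= s.
    rewrite -lee_fin; apply: le_trans (ltW abs).
    exact: le_trans (r_zero_ge_distortion a b i j) (r_zero_le_infty a b).
  by rewrite ler_pdivrMr// mulrC.
have s0 : 0 < s.
  rewrite -lte_fin; apply: le_lt_trans rs.
  exact: le_trans (r_zero_ge0 _ _) (r_zero_le_infty _ _).
have [L [QL Lhomo Lu Lv]] := back_and_forth u v Q0 Qext.
(* The correspondence is the union of all stages; any two of its pairs lie in a common stage, where
   [Qdist] bounds their distortion. *)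
apply: (@gromov_hausdorff_le_distortion R A B
  (fun a b => exists k, (a, b) \in L k) s s0).
- by have [b ub] := Lu 0; exists (u 0), b, 1.
- move=> a b a' b' [k abk] [m abm].
  apply: (Qdist _ (QL (maxn k m)) (a, b) (a', b')).
    exact: (Lhomo _ _ (leq_maxl _ _) _ abk).
  exact: (Lhomo _ _ (leq_maxr _ _) _ abm).
- move=> a e e0; have [k uk] := uP a e e0; have [b ub] := Lu k.
  by exists (u k), b; split => //; exists k.+1.
- move=> b e e0; have [k vk] := vP b e e0; have [a av] := Lv k.
  by exists a, (v k); split => //; exists k.+1.
Qed.

(** [A] itself serves as ambient space, and both [sup0] range over empty families, with value 0. *)
Lemma gromov_hausdorff_empty A B : ~ inhabited A -> ~ inhabited B ->
  (gromov_hausdorff_dist A B <= 0)%E.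
Proof.
move=> nA nB; have f (b : B) : A by case: nB.
apply: ge_ereal_inf; eexists.
  by exists A, id, f; split => // b; case: nB.
rewrite ge_max; apply/andP; split.
  by apply: ge_ereal_sup => x [->|[_ [a _ _] _]] //; case: nA.
by apply: ge_ereal_sup => x [->|[_ [b _ _] _]] //; case: nB.
Qed.

End BackAndForth.

(** [nonemptyAB] excludes the case of exactly one empty space. There [r_infty] of the empty tuples
    is 0, since formulas without variables are constants and no pair of points can be chosen,
    whereas the Hausdorff distance is [+oo]. *)
Theorem theorem8p1 (R : realType) (A B : metricType R)
    (nonemptyAB : inhabited A <-> inhabited B)
    (sepA : separable_space A) (sepB : separable_space B)
    (complA : complete_space A) (complB : complete_space B)
    (diamA : diameter_le1 A) (diamB : diameter_le1 B) :
  r_infty (nil_tuple A) (nil_tuple B) = gromov_hausdorff_dist A B.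
Proof.
apply/eqP; rewrite eq_le r_infty_le_gromov_hausdorff//=.
have [iA|nA] := pselect (inhabited A).
  by apply: gromov_hausdorff_le_r_infty => //; exact/nonemptyAB.
apply: le_trans (gromov_hausdorff_empty nA _) _; first by move=> /nonemptyAB.
exact: le_trans (r_zero_ge0 _ _) (r_zero_le_infty _ _).
Qed.
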